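(* For every integer $n\ge 1$ there exists a constant $N\in\mathbb{N}$, depending only on $n$, such that for every symplectic manifold $(M,\omega)$ of dimension $2n$ the following holds: for any functions $F_1,\ldots,F_N\in C^\infty_c(M)$ and any $\varepsilon>0$ there exist functions $F'_1,\ldots,F'_N\in C^\infty_c(M)$ with $\|F'_i-F_i\|<\varepsilon$ for all $i=1,\ldots,N$ and $$\{F'_1,\{F'_2,\ldots\{F'_{N-1},F'_N\}\ldots\}\}\equiv 0 .$$
   Context: $(M,\omega)$ may be open or closed. $C^\infty_c(M)$ is the space of smooth compactly supported real-valued functions on $M$, with the uniform norm $\|F\|=\max_{x\in M}|F(x)|$. The Poisson bracket is $\{F,G\}=dF(X_G)$, where $X_G$ is the Hamiltonian vector field of $G$ with respect to $\omega$. The displayed expression is the iterated (right-nested) Poisson bracket of the $N$ functions. *)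

(* Defs.v *)
From HB Require Import structures.
From mathcomp Require Import all_boot all_order all_algebra.
From mathcomp Require Import all_classical all_reals all_analysis.

Set Implicit Arguments.
Unset Strict Implicit.
Unset Printing Implicit Defensive.

Import Order.TTheory GRing.Theory Num.Theory.
Import numFieldNormedType.Exports.

Local Open Scope classical_set_scope.
Local Open Scope ring_scope.

Section Smooth.
Context {R : realType} {V W : normedModType R}.

(* Meant for U open: then only the values of f on U matter. *)
Fixpoint Ck_on (k : nat) (U : set V) (f : V -> W) : Prop :=
  match k with
  | 0 => forall x, U x -> {for x, continuous f}
  | k'.+1 => (forall x, U x -> differentiable f x) /\
             (forall v : V, Ck_on k' U ('D_v f))
  end.

Definition smooth_on (U : set V) (f : V -> W) : Prop :=
  forall k, Ck_on k U f.

End Smooth.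

(* chart_inv is only meaningful on the open set chart_map @` chart_dom. *)
Record chart (R : realType) (m : nat) (M : topologicalType) := Chart {
  chart_dom : set M;
  chart_map : M -> 'rV[R]_m;
  chart_inv : 'rV[R]_m -> M;
  chart_dom_open : open chart_dom;
  chart_codom_open : open (chart_map @` chart_dom);
  chart_mapK : forall p, chart_dom p -> chart_inv (chart_map p) = p;
  chart_map_continuous :
    forall p, chart_dom p -> {for p, continuous chart_map};
  chart_inv_continuous :
    forall x, (chart_map @` chart_dom) x -> {for x, continuous chart_inv}
}.

Definition chart_codom (R : realType) (m : nat) (M : topologicalType)
  (c : chart R m M) : set 'rV[R]_m := chart_map c @` chart_dom c.

Definition chart_overlap (R : realType) (m : nat) (M : topologicalType)
    (c d : chart R m M) : set 'rV[R]_m :=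
  chart_map c @` (chart_dom c `&` chart_dom d).

Definition transition (R : realType) (m : nat) (M : topologicalType)
  (c d : chart R m M) : 'rV[R]_m -> 'rV[R]_m := chart_map d \o chart_inv c.

(* Manifolds without boundary, neither connected nor compact in general. The
   smooth structure is given by an atlas that need not be maximal. *)
Record smooth_manifold (R : realType) (m : nat) := SmoothManifold {
  mfd_space :> topologicalType;
  mfd_hausdorff : hausdorff_space mfd_space;
  mfd_second_countable : @second_countable mfd_space;
  mfd_index : Type;
  atlas : mfd_index -> chart R m mfd_space;
  chart_at : mfd_space -> mfd_index;
  chart_atP : forall p, chart_dom (atlas (chart_at p)) p;
  transition_smooth : forall i j,
    smooth_on (chart_overlap (atlas i) (atlas j))
              (transition (atlas i) (atlas j))
}.

(* The bilinear form on R^m with Gram matrix A. *)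
Definition mx_form (R : realType) (m : nat) (A : 'M[R]_m) (u v : 'rV[R]_m) : R :=
  (u *m A *m v^T) 0 0.

(* A symplectic form is given by its coefficient matrices in the charts of the
   atlas. In symplectic_closed the left-hand side is
   (d omega)(u, v, w) for the constant vector fields u, v, w on the chart;
   symplectic_compat says that transition maps pull the local forms back to
   one another. *)
Record symplectic_manifold (R : realType) (m : nat) := SymplecticManifold {
  symp_mfd :> smooth_manifold R m;
  symp_coef : mfd_index symp_mfd -> 'rV[R]_m -> 'M[R]_m;
  symp_coef_smooth : forall i,
    smooth_on (chart_codom (atlas i)) (symp_coef i);
  symplectic_alternating : forall i x u, chart_codom (atlas i) x ->
    mx_form (symp_coef i x) u u = 0;
  symplectic_nondegenerate : forall i x u, chart_codom (atlas i) x ->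
    (forall v, mx_form (symp_coef i x) u v = 0) -> u = 0;
  symplectic_closed : forall i x u v w, chart_codom (atlas i) x ->
    'D_u (fun y => mx_form (symp_coef i y) v w) x +
    'D_v (fun y => mx_form (symp_coef i y) w u) x +
    'D_w (fun y => mx_form (symp_coef i y) u v) x = 0;
  symplectic_compat : forall i j x u v,
    chart_overlap (atlas i) (atlas j) x ->
    let tau := transition (atlas i) (atlas j) in
    mx_form (symp_coef i x) u v =
    mx_form (symp_coef j (tau x)) ('d tau x u) ('d tau x v)
}.

Section Functions.
Context {R : realType} {m : nat} (M : smooth_manifold R m).

Definition local_expr (i : mfd_index M) (F : M -> R) : 'rV[R]_m -> R :=
  F \o chart_inv (atlas i).

Definition smooth_fun (F : M -> R) : Prop :=
  forall i, smooth_on (chart_codom (atlas i)) (local_expr i F).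

Definition Cc_infty : set (M -> R) :=
  [set F | smooth_fun F /\ compact (closure [set p | F p != 0])].

(* For F in Cc_infty this is the maximum of |F|; on the empty manifold it
   is 0. For unbounded F it is the junk value 0. *)
Definition uniform_norm (F : M -> R) : R := sup [set `|F p| | p in [set: M]].

End Functions.

Arguments Cc_infty {R m} M.

Section PoissonBracket.
Context {R : realType} {m : nat} (M : symplectic_manifold R m).

(* The vector X_G in the chart i at x, with the sign convention
   omega(X_G, v) = - dG(v); it is unique by nondegeneracy. *)
Definition ham_vec (G : M -> R) (i : mfd_index M) (x : 'rV[R]_m) : 'rV[R]_m :=
  xget 0 [set X | forall v,
    mx_form (symp_coef i x) X v = - 'd (local_expr i G) x v].

Definition chart_bracket (F G : M -> R) (i : mfd_index M) (x : 'rV[R]_m) : R :=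
  'd (local_expr i F) x (ham_vec G i x).

(* {F, G} = dF(X_G); for smooth F and G any other chart around p gives the
   same value, see poisson_chartE. *)
Definition poisson (F G : M -> R) : M -> R := fun p =>
  chart_bracket F G (chart_at p) (chart_map (atlas (chart_at p)) p).

(* {F_1, {F_2, ... {F_(k-1), F_k} ... }} *)
Fixpoint nested_bracket (s : seq (M -> R)) : M -> R :=
  match s with
  | [::] => fun=> 0
  | [:: F] => F
  | F :: s' => poisson F (nested_bracket s')
  end.

End PoissonBracket.

Section ChartIndependence.
Context {R : realType} {m : nat} {M : symplectic_manifold R m}.
Implicit Types (F G : M -> R) (i j : mfd_index M).

Lemma smooth_on_differentiable (V W : normedModType R) (U : set V)
    (f : V -> W) x :
  smooth_on U f -> U x -> differentiable f x.
Proof. by move=> /(_ 1%N)[+ _] Ux; apply. Qed.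

Lemma near_eq_diff (V W : normedModType R) (f g : V -> W) x v :
  differentiable f x -> differentiable g x -> (\near x, f x = g x) ->
  'd f x v = 'd g x v.
Proof.
have [-> *|v0 df dg fg] := eqVneq v 0; first by rewrite !linear0.
by rewrite -!deriveE//; exact: near_eq_derive.
Qed.

Lemma diff_comp_at (U V W : normedModType R) (f : U -> V) (g : V -> W) x y u :
  f x = y -> differentiable f x -> differentiable g y ->
  'd (g \o f) x u = 'd g y ('d f x u).
Proof. by move=> <- df dg; rewrite (diff_comp df dg). Qed.

Lemma differentiable_comp_at (U V W : normedModType R) (f : U -> V)
    (g : V -> W) x y :
  f x = y -> differentiable f x -> differentiable g y ->
  differentiable (g \o f) x.
Proof. by move=> <-; exact: differentiable_comp. Qed.

Lemma mx_formBl (A : 'M[R]_m) u v w :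
  mx_form A (u - v) w = mx_form A u w - mx_form A v w.
Proof. by rewrite /mx_form !mulmxBl !mxE. Qed.

Lemma near_overlap i j p : chart_dom (atlas i) p -> chart_dom (atlas j) p ->
  \forall z \near chart_map (atlas i) p, chart_overlap (atlas i) (atlas j) z.
Proof.
move=> ip jp; have cp : chart_codom (atlas i) (chart_map (atlas i) p).
  by exists p.
have jV : \forall z \near chart_map (atlas i) p,
    chart_dom (atlas j) (chart_inv (atlas i) z).
  apply: (chart_inv_continuous cp).
  by rewrite chart_mapK//; apply: open_nbhs_nbhs; split; [exact: chart_dom_open|].
have iV : \forall z \near chart_map (atlas i) p, chart_codom (atlas i) z.
  by apply: open_nbhs_nbhs; split; [exact: chart_codom_open|].
near=> z; have [q iq zq] : chart_codom (atlas i) z by near: z.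
have : chart_dom (atlas j) (chart_inv (atlas i) z) by near: z.
by rewrite -zq chart_mapK// => jq; exists q.
Unshelve. all: by end_near.
Qed.

Lemma ham_vecP i x G v : chart_codom (atlas i) x ->
  mx_form (symp_coef i x) (ham_vec G i x) v = - 'd (local_expr i G) x v.
Proof.
move=> ix; set A := symp_coef i x; set L := 'd (local_expr i G) x.
suff [X HX] : exists X, forall v, mx_form A X v = - L v.
  by rewrite /ham_vec; case: xgetP => [Y _ ->//|/(_ X)].
have uA : A \in unitmx.
  rewrite -row_free_unit -kermx_eq0; apply/eqP/row_matrixP => k.
  rewrite row0; apply: (symplectic_nondegenerate ix) => w.
  by rewrite /mx_form -row_mul mulmx_ker row0 mul0mx mxE.
exists (- (\row_k L (delta_mx 0 k)) *m invmx A) => w.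
rewrite /mx_form mulmxKV// mulNmx mxE; congr (- _).
rewrite mxE [in RHS](row_sum_delta w) linear_sum; apply: eq_bigr => k _.
by rewrite !mxE linearZ mulrC.
Qed.

Lemma chart_bracketE i j p F G : smooth_fun F -> smooth_fun G ->
  chart_dom (atlas i) p -> chart_dom (atlas j) p ->
  chart_bracket F G i (chart_map (atlas i) p) =
  chart_bracket F G j (chart_map (atlas j) p).
Proof.
move=> sF sG ip jp.
set x := chart_map (atlas i) p; set y := chart_map (atlas j) p.
set tau := transition (atlas i) (atlas j).
set sig := transition (atlas j) (atlas i).
have ox : chart_overlap (atlas i) (atlas j) x by exists p.
have oy : chart_overlap (atlas j) (atlas i) y by exists p.
have cx : chart_codom (atlas i) x by exists p.
have cy : chart_codom (atlas j) y by exists p.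
have tx : tau x = y by rewrite /tau /transition /= chart_mapK.
have sy : sig y = x by rewrite /sig /transition /= chart_mapK.
have dt : differentiable tau x.
  exact: smooth_on_differentiable (transition_smooth i j) ox.
have ds : differentiable sig y.
  exact: smooth_on_differentiable (transition_smooth j i) oy.
have dH H : smooth_fun H -> forall v,
    'd (local_expr i H) x v = 'd (local_expr j H) y ('d tau x v).
  move=> sH v.
  have di := smooth_on_differentiable (sH i) cx.
  have dj := smooth_on_differentiable (sH j) cy.
  apply: (@etrans _ _ ('d (local_expr j H \o tau) x v));
    last exact (diff_comp_at v tx dt dj).
  apply: (near_eq_diff v di (differentiable_comp_at tx dt dj)).
  apply: filterS (near_overlap ip jp) => _ [q [iq jq] <-].
  by rewrite /local_expr /tau /transition /= !chart_mapK.
have ts w : 'd tau x ('d sig y w) = w.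
  rewrite -(diff_comp_at w sy ds dt).
  have [did idE] : is_diff y id id by exact: is_diff_id.
  apply: (@etrans _ _ ('d id y w)); last by rewrite idE.
  apply: (near_eq_diff w (differentiable_comp_at sy ds dt) did).
  apply: filterS (near_overlap jp ip) => _ [q [jq iq] <-].
  by rewrite /sig /tau /transition /= !chart_mapK.
suff E : ham_vec G j y = 'd tau x (ham_vec G i x).
  exact (etrans (dH F sF _) (congr1 ('d (local_expr j F) y) (esym E))).
apply/eqP; rewrite -subr_eq0; apply/eqP.
apply: (symplectic_nondegenerate cy) => w.
rewrite mx_formBl (ham_vecP _ _ cy) -(ts w) -(dH G sG).
have := symplectic_compat (ham_vec G i x) ('d sig y w) ox.
by rewrite /= -/tau tx => <-; rewrite (ham_vecP _ _ cx) subrr.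
Qed.

Lemma poisson_chartE i p F G : smooth_fun F -> smooth_fun G ->
  chart_dom (atlas i) p ->
  poisson F G p = chart_bracket F G i (chart_map (atlas i) p).
Proof. by move=> sF sG ip; apply: chart_bracketE => //; exact: chart_atP. Qed.

End ChartIndependence.

(* Main.v *)
Require Import Defs.
From mathcomp Require Import all_boot all_order all_algebra.
From mathcomp Require Import all_classical all_reals all_analysis.
From mathcomp Require Import ring lra zify.

Set Implicit Arguments.
Unset Strict Implicit.
Unset Printing Implicit Defensive.

Import Order.TTheory GRing.Theory Num.Theory.
Import numFieldNormedType.Exports.

Local Open Scope classical_set_scope.
Local Open Scope ring_scope.

(** Take N = 2n + 1 and put F'_i = phi_i o F_i, where phi_i : R -> R is a smooth
staircase, uniformly close to the identity, with phi_i(0) = 0, and locally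
constant away from the e-neighbourhood of a grid a_i + d Z of step d of order
eps. Then F'_i is close to F_i, has support inside that of F_i, and is locally
constant near every point p whose value F_i(p) is at distance more than e from
the grid. The Poisson bracket only sees first derivatives: as soon as one of the
entries of an iterated bracket is locally constant near p, the bracket vanishes
near p ([nested_bracket_locally_cst]). So it suffices to choose the offsets a_i
and the margin e so that at every point p at least one F_i(p) stays e-far from
its grid ([avoiding_grids]).

Such offsets exist because the map (F_1, ..., F_N) goes from dimension 2n to
dimension 2n + 1, so its image is too thin to meet all translates of a grid.
Sard's theorem or measure theory can be replaced by a count. The functions are
Lipschitz in charts and have compact support, so for every m the manifold
splits into at most C m^(2n) cells on each of which every F_i oscillates by at
most C / m ([Cc_infty_cellular]). Divide the step d into t equal parts of length
r. There are t^(2n+1) possible offset vectors with entries in r Z modulo d.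
When m is a large multiple of t, each F_i oscillates by much less than r on a
cell, so that a cell is close to the grids of at most one offset vector. The
number of spoiled vectors is therefore at most a constant times t^(2n), and for
large t some vector is left. *)

(** * Calculus of C^k maps *)

Lemma derive_line {R : realType} (phi : R -> R) (x v : R) :
  differentiable phi x -> 'D_v phi x = v * 'D_1 phi x.
Proof. by move=> dphi; rewrite (deriveE v dphi) (diff1E dphi) -derive1E. Qed.

Section CkCalculus.
Context {R : realType} {V : normedModType R}.
Implicit Types (U : set V) (k : nat).

(** Differentiability is local. This lets derivatives be computed by formulas
that hold only on an open set. *)
Lemma near_eq_differentiable {W : normedModType R} (f g : V -> W) (x : V) :
  {near x, f =1 g} -> differentiable f x -> differentiable g x.
Proof.
move=> fg df; have [dfc dfE] := (diff_locallyP x f).1 df.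
have E : g \o shift x = cst (g x) + 'd f x +o_ 0 id.
  have fg0 : \forall y \near 0, f (y + x) = g (y + x).
    have : (y + x) @[y --> 0] --> x.
      by rewrite -[X in _ --> X]add0r; apply: cvgD; [exact: cvg_id|exact: cvg_cst].
    by move=> H; exact: (H [set y | f y = g y] fg).
  apply/eqaddoP => e e0.
  have /eqaddoP/(_ e e0) := dfE; apply: filterS2 fg0 => y fgy.
  by rewrite !fctE /= fgy (nbhs_singleton fg).
by apply/diff_locallyP; rewrite (diff_unique dfc E).
Qed.

Lemma Ck_on_ext {W : normedModType R} k U (f g : V -> W) : open U ->
  (forall x, U x -> f x = g x) -> Ck_on k U f -> Ck_on k U g.
Proof.
move=> oU; have nearU x h1 h2 : U x -> (forall x, U x -> h1 x = h2 x :> W) ->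
    {near x, h1 =1 h2}.
  by move=> Ux E; apply: filterS E _; exact: open_nbhs_nbhs.
elim: k f g => [|k IH] f g fg /=.
  move=> cf x Ux; have H : f @ x --> g x by rewrite -fg//; exact: cf.
  by apply: cvg_trans H; apply: near_eq_cvg; exact: nearU.
move=> [df Df]; split => [x Ux|v].
    by apply: near_eq_differentiable (df x Ux); exact: nearU.
apply: IH (Df v) => x Ux; apply: near_eq_derive; exact: nearU.
Qed.

Lemma Ck_onW {W : normedModType R} k U (f : V -> W) :
  Ck_on k.+1 U f -> Ck_on k U f.
Proof.
elim: k f => [|k IH] f [df Df].
  by move=> x Ux; exact: differentiable_continuous (df x Ux).
by split => // v; exact: IH (Df v).
Qed.

Lemma Ck_on_cst {W : normedModType R} k U (c : W) : Ck_on k U (cst c).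
Proof.
elim: k c => [|k IH] c /=; first by move=> x _; exact: cvg_cst.
split=> [x _|v]; first exact: differentiable_cst.
by rewrite (_ : 'D_v (cst c) = cst 0)//; apply/funext => x; rewrite derive_cst.
Qed.

Lemma Ck_onD {W : normedModType R} k U (f g : V -> W) : open U ->
  Ck_on k U f -> Ck_on k U g -> Ck_on k U (f + g).
Proof.
move=> oU; elim: k f g => [|k IH] f g /=.
  by move=> cf cg x Ux; apply: cvgD; [exact: cf|exact: cg].
move=> [df Df] [dg Dg]; split=> [x Ux|v].
  by apply: differentiableD; auto.
apply: Ck_on_ext (IH _ _ (Df v) (Dg v)) => // x Ux.
by rewrite deriveD//; apply: diff_derivable; auto.
Qed.

(** Leibniz' rule expresses the derivatives of a product through products of
maps of lower regularity; [Ck_onW] brings the undifferentiated factors down to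
that regularity. The same pattern serves for inverses and compositions. *)
Lemma Ck_onM k U (f g : V -> R) : open U ->
  Ck_on k U f -> Ck_on k U g -> Ck_on k U (f * g).
Proof.
move=> oU; elim: k f g => [|k IH] f g /=.
  by move=> cf cg x Ux; apply: cvgM; [exact: cf|exact: cg].
move=> Cf Cg; have [df Df] := Cf; have [dg Dg] := Cg; split=> [x Ux|v].
  by apply: differentiableM; auto.
apply: Ck_on_ext (Ck_onD oU (IH _ _ (Ck_onW Cf) (Dg v))
  (IH _ _ (Ck_onW Cg) (Df v))) => // x Ux.
by rewrite deriveM//; apply: diff_derivable; auto.
Qed.

Lemma Ck_onV k U (f : V -> R) : open U -> (forall x, U x -> f x != 0) ->
  Ck_on k U f -> Ck_on k U (fun x => (f x)^-1).
Proof.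
move=> oU f0; elim: k => [|k IH] Cf.
  by move=> x Ux; apply: cvgV; [exact: f0|exact: Cf].
have [df Df] := Cf; have CV := IH (Ck_onW Cf).
split=> [x Ux|v]; first by apply: differentiableV; auto.
apply: Ck_on_ext (Ck_onM oU (Ck_on_cst k U (-1 : R))
  (Ck_onM oU (Ck_onM oU CV CV) (Df v))) => // x Ux.
rewrite deriveV; [|exact: f0|by apply: diff_derivable; auto].
by rewrite /= -[LHS]/(-1 * ((f x)^-1 * (f x)^-1 * _)) -exprVn expr2 mulN1r -mulNr.
Qed.

Lemma Ck_on_comp k U (f : V -> R) (phi : R -> R) : open U ->
  Ck_on k [set: R] phi -> Ck_on k U f -> Ck_on k U (phi \o f).
Proof.
move=> oU; elim: k phi => [|k IH] phi.
  by move=> cp cf x Ux; apply: continuous_comp; [exact: cf|exact: cp].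
move=> [dp Dp] Cf; have [df Df] := Cf; split=> [x Ux|v].
  by apply: differentiable_comp; [exact: df|exact: dp].
apply: Ck_on_ext (Ck_onM oU (Df v) (IH _ (Dp 1) (Ck_onW Cf))) => // x Ux.
have dpx := dp (f x) I; have dfx := df x Ux.
rewrite -[LHS]/('D_v f x * 'D_1 phi (f x)).
have dpf := differentiable_comp dfx dpx.
have -> := deriveE v dpf; have -> := diff_comp_at v (erefl (f x)) dfx dpx.
have -> := deriveE v dfx.
have <- := deriveE ('d f x v) dpx.
by rewrite [RHS](derive_line _ dpx).
Qed.

End CkCalculus.

(** * Flat functions *)

Section FlatFunctions.
Context {R : realType}.
Implicit Types (x t : R) (m k : nat).

(** The powers of 1/x make the span of the family stable under differentiation,
so that the smoothness of all its members is proved by one induction. *)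
Definition flat m x : R :=
  if 0 < x then x^-1 ^+ m * expR (- x^-1) else 0.

Lemma flat_ge0 m x : 0 <= flat m x.
Proof.
rewrite /flat; case: ltrP => // x0.
by rewrite mulr_ge0 ?expR_ge0// exprn_ge0// invr_ge0 ltW.
Qed.

Lemma flat_gt0 m x : 0 < x -> 0 < flat m x.
Proof. by move=> x0; rewrite /flat x0 mulr_gt0 ?expR_gt0// exprn_gt0 ?invr_gt0. Qed.

Lemma flat_eq0 m x : x <= 0 -> flat m x = 0.
Proof. by rewrite /flat ltNge => ->. Qed.

(** With y = 1/x, this is y^(m+2) <= (m+2)! exp(y), a term of the exponential
series. The factor x^2 is what gives differentiability at 0. *)
Lemma flat_le m x : flat m x <= (m.+2)`!%:R * x ^+ 2.
Proof.
rewrite /flat; case: ltrP => x0; last by rewrite mulr_ge0// sqr_ge0.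
set y := x^-1; have y0 : 0 < y by rewrite invr_gt0.
have -> : x = y^-1 by rewrite invrK.
rewrite expRN [y^-1 ^+ 2]exprVn.
rewrite ler_pdivrMr ?expR_gt0// mulrAC ler_pdivlMr ?exprn_gt0// -exprD addn2.
rewrite mulrC -ler_pdivrMr ?ltr0n ?fact_gt0//.
by apply: le_trans (expR_ge1Dxn m.+1 (ltW y0)); rewrite lerDr.
Qed.

Lemma is_derive_flat m x :
  is_derive x 1 (flat m) (flat m.+2 x - m%:R * flat m.+1 x).
Proof.
have [x0|x0|->] := ltrgt0P x.
- pose y : R -> R := fun t => t^-1.
  have dy : is_derive x 1 y (- y x ^+ 2).
    apply: is_derive_eq (@is_deriveV R id x 1 1 (lt0r_neq0 x0) (is_derive_id x 1)) _.
    by rewrite /y -exprVn /GRing.scale /= mulr1.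
  have dE := @is_derive1_comp R expR (- y) x _ _ (is_derive_expR _) (is_deriveN dy).
  have E : {near x, y ^+ m * (expR \o - y) =1 flat m}.
    near=> t; rewrite /flat ifT//; last by near: t; exact: lt_nbhsr.
    by rewrite !fctE.
  apply: near_eq_is_derive E (is_derive_eq (is_deriveM (is_deriveX m dy) dE) _).
  rewrite /flat x0 /= -[x^-1]/(y x) /GRing.scale /= !fctE.
  by case: m => [|m]; rewrite ?mul0r ?expr0 ?mulr0n /= ?exprS; ring.
- rewrite !flat_eq0 ?ltW// mulr0 subr0.
  apply: near_eq_is_derive _ (is_derive_cst (0 : R) x 1).
  near=> t; rewrite flat_eq0// ltW//; near: t; exact: lt_nbhsl.
- rewrite !flat_eq0// mulr0 subr0.
  suff H : (fun h : R => h^-1 *: ((flat m \o shift 0) (h *: (1 : R)) - flat m 0))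
      @ 0^' --> (0 : R).
    by apply: DeriveDef; [apply/cvg_ex; exists 0|exact: cvg_lim H].
  apply/cvgr0Pnorm_le => e e0; near=> h.
  rewrite /= addr0 (flat_eq0 m (lexx 0)) subr0 /GRing.scale /= mulr1.
  rewrite normrM normfV (ger0_norm (flat_ge0 _ _)).
  have h0 : 0 < `|h| by rewrite normr_gt0; near: h; exact: nbhs_dnbhs_neq.
  rewrite mulrC ler_pdivrMr//; apply: le_trans (flat_le _ _) _.
  rewrite -real_normK ?num_real// expr2 mulrA ler_wpM2r//.
  rewrite mulrC -ler_pdivlMr ?ltr0n ?fact_gt0//.
  near: h; apply: dnbhs0_le; rewrite divr_gt0// ltr0n fact_gt0//.
Unshelve. all: by end_near. Qed.

Lemma Ck_on_flat k m : Ck_on k [set: R] (flat m).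
Proof.
elim: k m => [|k IH] m.
  move=> x _; apply: differentiable_continuous; apply/derivable1_diffP.
  exact: (@ex_derive _ _ _ _ _ _ _ (is_derive_flat m x)).
have dfl x : differentiable (flat m) x.
  apply/derivable1_diffP; exact: (@ex_derive _ _ _ _ _ _ _ (is_derive_flat m x)).
split=> [x _|v]; first exact: dfl.
have H := Ck_onM openT (Ck_on_cst k setT (v : R)) (Ck_onD openT (IH m.+2)
  (Ck_onM openT (Ck_on_cst k setT (- m%:R : R)) (IH m.+1))).
apply: Ck_on_ext openT _ H => x _.
rewrite -[LHS]/(v * (flat m.+2 x + - m%:R * flat m.+1 x)) mulNr.
rewrite (derive_line _ (dfl x)); congr (_ * _).
by rewrite (@derive_val _ _ _ _ _ _ _ (is_derive_flat m x)).
Qed.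

End FlatFunctions.

(** * Smooth staircases *)

Section Staircases.
Context {R : realType}.
Implicit Types (x t a d e : R) (n k : nat).

Definition smooth_step x : R := flat 0 x / (flat 0 x + flat 0 (1 - x)).

Lemma smooth_step_den_gt0 x : 0 < flat 0 x + flat 0 (1 - x).
Proof.
have [x0|x0] := ltrP 0 x; first by rewrite ltr_wpDr ?flat_ge0 ?flat_gt0.
by rewrite ltr_wpDl ?flat_ge0 ?flat_gt0//; lra.
Qed.

Lemma smooth_step_itv x : 0 <= smooth_step x <= 1.
Proof.
rewrite /smooth_step divr_ge0 ?flat_ge0//= ?(ltW (smooth_step_den_gt0 _))//.
by rewrite ler_pdivrMr ?smooth_step_den_gt0// mul1r lerDl flat_ge0.
Qed.

Lemma smooth_step_eq0 x : x <= 0 -> smooth_step x = 0.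
Proof. by move=> x0; rewrite /smooth_step flat_eq0// mul0r. Qed.

Lemma smooth_step_eq1 x : 1 <= x -> smooth_step x = 1.
Proof.
move=> x1; rewrite /smooth_step (@flat_eq0 _ _ (1 - x)) ?subr_le0// addr0 divff//.
by rewrite gt_eqF// flat_gt0//; lra.
Qed.

Lemma Ck_on_affine k (a b : R) : Ck_on k [set: R] (fun x => a * x + b).
Proof.
have Cid : Ck_on k [set: R] (id : R -> R).
  case: k => [|k]; first by move=> x _; exact: cvg_id.
  split=> [x _|v]; first by apply/derivable1_diffP; exact: derivable_id.
  apply: Ck_on_ext openT _ (Ck_on_cst k setT (v : R)) => x _.
  by rewrite derive_id.
exact (Ck_onD openT (Ck_onM openT (Ck_on_cst k setT a) Cid) (Ck_on_cst k setT b)).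
Qed.

Lemma Ck_on_smooth_step k : Ck_on k [set: R] smooth_step.
Proof.
have H : Ck_on k [set: R] (fun x => flat 0 x + flat 0 (1 - x)).
  apply: (Ck_onD openT (Ck_on_flat k 0)).
  apply: Ck_on_ext openT _ (Ck_on_comp openT (Ck_on_flat k 0) (Ck_on_affine k (-1) 1)).
  by move=> x _ /=; congr (flat 0 _); ring.
apply: (Ck_onM openT (Ck_on_flat k 0) (Ck_onV openT _ H)) => x _.
by rewrite gt_eqF// smooth_step_den_gt0.
Qed.

Definition staircase d e a n t : R :=
  \sum_(k < n) d * smooth_step ((t - (a + k%:R * d) + e) / (2 * e)).

Lemma Ck_on_staircase d e a n k : Ck_on k [set: R] (staircase d e a n).
Proof.
elim: n => [|n IH].
  apply: Ck_on_ext openT _ (Ck_on_cst k setT (0 : R)) => x _.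
  by rewrite /staircase big_ord0.
have H := Ck_on_comp openT (Ck_on_smooth_step k)
  (Ck_on_affine k (2 * e)^-1 ((e - (a + n%:R * d)) / (2 * e))).
apply: Ck_on_ext openT _ (Ck_onD openT IH (Ck_onM openT (Ck_on_cst k setT d) H)).
move=> x _; rewrite /staircase big_ord_recr; congr (_ + d * smooth_step _) => /=.
by ring.
Qed.

(** By induction on the number of steps: to the left of the last step the last
summand vanishes; elsewhere all earlier steps are complete, because the
transition intervals are disjoint when 2 e <= d. *)
Lemma staircase_approx d e a n t : 0 < e -> 2 * e <= d ->
  a - d <= t <= a + n%:R * d -> `|staircase d e a n t - (t - a)| <= 2 * d.
Proof.
move=> e0 ed; elim: n => [|n IH] /andP[at_ ta].
  rewrite /staircase big_ord0 ler_norml; apply/andP; split; lra.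
rewrite /staircase big_ord_recr /= -/(staircase d e a n t).
have nd : n.+1%:R * d = n%:R * d + d by rewrite -natr1; ring.
have [lt|gt] := lerP t (a + n%:R * d - e).
  rewrite smooth_step_eq0; last by rewrite pmulr_lle0 ?invr_gt0; lra.
  rewrite mulr0 addr0; apply: IH; rewrite at_ /=; lra.
have -> : staircase d e a n t = n%:R * d.
  transitivity (\sum_(i < n) d); last by rewrite sumr_const card_ord mulr_natl.
  apply: eq_bigr => i _.
  have e20 : 0 < 2 * e by lra.
  rewrite smooth_step_eq1; first by rewrite mulr1.
  rewrite ler_pdivlMr//.
  have : (i.+1%:R : R) <= n%:R by rewrite ler_nat.
  have d0 : 0 <= d by lra.
  move=> /(ler_wpM2r d0); rewrite -natr1; lra.
have /andP[s0 s1] := smooth_step_itv ((t - (a + n%:R * d) + e) / (2 * e)).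
have d0 : 0 <= d by lra.
move: (smooth_step _) s0 s1 => s s0 s1.
have := ler_wpM2l d0 s0; have := ler_wpM2l d0 s1; rewrite mulr0 mulr1 => ds1 ds0.
rewrite ler_norml; apply/andP; split; lra.
Qed.

Lemma staircase_locally_cst d e a n t : 0 < e ->
  (forall k, e < `|t - (a + k%:R * d)|) ->
  \forall u \near t, staircase d e a n u = staircase d e a n t.
Proof.
move=> e0 te; elim: n => [|n IH].
  by near=> u; rewrite /staircase !big_ord0.
rewrite /staircase.
have S : \forall u \near t,
    smooth_step ((u - (a + n%:R * d) + e) / (2 * e)) =
    smooth_step ((t - (a + n%:R * d) + e) / (2 * e)).
  have e20 : 0 < 2 * e by lra.
  have := te n; rewrite lter_normr => /orP[gt|lt].
    have H : a + n%:R * d + e < t by lra.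
    near=> u; have : a + n%:R * d + e < u by near: u; exact: lt_nbhsr.
    by move=> Hu; rewrite !smooth_step_eq1// ler_pdivlMr//; lra.
  have H : t < a + n%:R * d - e by lra.
  near=> u; have : u < a + n%:R * d - e by near: u; exact: lt_nbhsl.
  by move=> Hu; rewrite !smooth_step_eq0// pmulr_lle0 ?invr_gt0//; lra.
apply: filterS2 IH S => u IHu Su.
by rewrite !big_ord_recr /= Su; congr (_ + _).
Unshelve. all: by end_near. Qed.

(** Subtracting the value at 0 from a staircase doubles the error but fixes 0,
so that composition with the resulting function does not enlarge supports. *)
Lemma exists_quantizer d e a B : 0 < e -> 2 * e <= d -> a - d <= - B -> 0 <= B ->
  exists phi : R -> R,
  [/\ forall k, Ck_on k [set: R] phi, phi 0 = 0,
      forall t, `|t| <= B -> `|phi t - t| <= 4 * d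
    & forall t, (forall k, e < `|t - (a + k%:R * d)|) ->
        \forall u \near t, phi u = phi t].
Proof.
move=> e0 ed aB B0; have d0 : 0 < d by lra.
pose n := Num.bound ((B - a) / d).
have nP : B <= a + n%:R * d.
  have [ba|ba] := lerP (B - a) 0.
    by rewrite -lerBlDl (le_trans ba)// mulr_ge0// ltW.
  have := archi_boundP (ltW (divr_gt0 ba d0)); rewrite ltr_pdivrMr// => /ltW.
  by rewrite /n; lra.
pose S := staircase d e a n; exists (fun t => S t - S 0); split.
- move=> k; exact (Ck_onD openT (Ck_on_staircase d e a n k) (Ck_on_cst k setT (- S 0))).
- exact: subrr.
- move=> t; rewrite ler_norml => /andP[Bt tB].
  have : `|S t - (t - a)| <= 2 * d by apply: staircase_approx => //; apply/andP; split; lra.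
  have : `|S 0 - (0 - a)| <= 2 * d by apply: staircase_approx => //; apply/andP; split; lra.
  by rewrite !ler_norml => /andP[? ?] /andP[? ?]; apply/andP; split; lra.
- move=> t /(staircase_locally_cst n e0); apply: filterS => u /= E.
  by rewrite /S E.
Qed.

End Staircases.

(** * Decomposition into cells of small oscillation *)

(** If K fails P, the sets B such that K minus B satisfies P form a proper
filter containing K. Near a cluster point of it in K, the local hypothesis
gives a neighbourhood whose complement belongs to the filter: a
contradiction. *)
Lemma compact_ind (T : topologicalType) (P : set T -> Prop) (K : set T) :
  compact K -> P set0 -> (forall A B, A `<=` B -> P B -> P A) ->
  (forall A B, P A -> P B -> P (A `|` B)) ->
  (forall p, K p -> exists2 U, nbhs p U & P U) -> P K.
Proof.
move=> cK P0 PS PU Ploc; apply: contrapT => nPK.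
pose F : set_system T := [set B | P (K `\` B)].
have FF : ProperFilter F.
  apply: Build_ProperFilter.
    by rewrite /F /= setD0.
  split.
  - by rewrite /F /= setDT.
  - by move=> A B FA FB; rewrite /F /= setDIr; exact: PU.
  - by move=> A B AB; apply: PS; exact: setDS.
have FK : F K by rewrite /F /= setDv.
have [p [Kp clp]] := cK F FF FK.
have [U nU PU'] := Ploc p Kp.
have FU : F (~` U) by apply: PS PU' => q [_ /contrapT].
by have [q []] := clp _ _ FU nU.
Qed.

Section Cells.
Context {R : realType} {T : Type} {N : nat} (F : 'I_N -> T -> R) (D : nat).

(** A quantitative form of: the image of A under (F_i) is bounded, of upper box
dimension at most D, up to a constant at every scale 1/m. One constant C bounds the functions, the number of cells and the oscillation, so
that finite unions only require adding constants. *)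
Definition cellular (A : set T) : Prop :=
  exists C : nat, (forall p i, A p -> `|F i p| <= C%:R) /\
  forall m, (0 < m)%N -> exists cell : T -> nat,
    (forall p, A p -> (cell p < C * m ^ D)%N) /\
    (forall p q i, A p -> A q -> cell p = cell q ->
      `|F i p - F i q| <= C%:R / m%:R).

Lemma cellularS A B : A `<=` B -> cellular B -> cellular A.
Proof.
move=> AB [C [FC cC]]; exists C; split=> [p i /AB|m m0]; first exact: FC.
have [cell [c1 c2]] := cC m m0; exists cell; split=> [p /AB|p q i /AB Bp /AB Bq].
  exact: c1.
exact: c2.
Qed.

Lemma cellular0 A : (forall p i, A p -> F i p = 0) -> cellular A.
Proof.
move=> F0; exists 1%N; split=> [p i Ap|m m0]; first by rewrite F0// normr0.
exists (fun=> 0%N); split=> [p Ap|p q i Ap Aq _].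
  by rewrite mul1n expn_gt0 m0.
by rewrite !F0// subrr normr0 divr_ge0.
Qed.

Lemma cellularU A B : cellular A -> cellular B -> cellular (A `|` B).
Proof.
move=> [C1 [F1 c1]] [C2 [F2 c2]]; exists (C1 + C2)%N.
have le1 : (C1%:R : R) <= (C1 + C2)%:R by rewrite ler_nat leq_addr.
have le2 : (C2%:R : R) <= (C1 + C2)%:R by rewrite ler_nat leq_addl.
split=> [p i [/(F1 _ i)|/(F2 _ i)] H|m m0].
- exact: le_trans H le1.
- exact: le_trans H le2.
have [cell1 [b1 d1]] := c1 m m0; have [cell2 [b2 d2]] := c2 m m0.
exists (fun p => if `[< A p >] then cell1 p else (C1 * m ^ D + cell2 p)%N).
have vm : 0 <= (m%:R : R)^-1 by rewrite invr_ge0.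
split=> [p ABp|p q i ABp ABq].
  rewrite mulnDl; case: asboolP => Ap.
    exact: leq_trans (b1 _ Ap) (leq_addr _ _).
  by case: ABp => // Bp; rewrite ltn_add2l; exact: b2.
case: asboolP => Ap; case: asboolP => Aq.
- by move=> E; apply: le_trans (d1 _ _ i Ap Aq E) _; rewrite ler_wpM2r.
- by move=> E; have := b1 _ Ap; rewrite E -ltn_subRL subnn.
- by move=> E; have := b1 _ Aq; rewrite -E -ltn_subRL subnn.
- case: ABp => // Bp; case: ABq => // Bq /addnI E.
  by apply: le_trans (d2 _ _ i Bp Bq E) _; rewrite ler_wpM2r.
Qed.

(** The pigeonhole argument. The candidate offsets are the vectors (j_i r),
0 <= j_i < t+1, with r = d / (t+1). All values of F_i that a given cell takes
within r/4 of r Z are near the same multiple of r, since the oscillation on the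
cell is at most r/8; so the cell determines at most one residue j_i for each i.
There are at most C ((t+1) Q)^D cells, fewer than the (t+1)^(D+1) candidates. *)
Lemma avoiding_grids (d B : R) : N = D.+1 -> 0 < d -> 0 <= B -> cellular setT ->
  exists (e : R) (a : 'I_N -> R), [/\ 0 < e, 2 * e <= d, forall i, a i - d <= - B &
    forall p, exists i, forall k : nat, e < `|F i p - (a i + k%:R * d)|].
Proof.
move=> ND d0 B0 [C [_ cC]].
(* Cells of mesh 1 / ((t+1) Q) make the oscillation at most r / 8; Q depends
   only on C and d, so t may be chosen after it. *)
pose Q := (Num.bound (8 * C%:R / d)).+1.
have QP : 8 * C%:R <= Q%:R * d.
  rewrite -ler_pdivrMr// ltW//; apply: lt_trans (archi_boundP _) _.
    by rewrite divr_ge0 ?mulr_ge0// ltW.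
  by rewrite ltr_nat.
pose t := (C * Q ^ D)%N.
have [|cell [cn dc]] := cC (t.+1 * Q)%N; first by rewrite muln_gt0.
set n := (C * _)%N in cn.
have nlt : (n < t.+1 ^ N)%N.
  by rewrite /n ND expnMn mulnCA expnSr ltn_pmul2l ?expn_gt0.
pose r := d / t.+1%:R.
have r0 : 0 < r by rewrite divr_gt0.
have dr : d = t.+1%:R * r by rewrite /r mulrC divfK.
have close p q i : cell p = cell q -> `|F i p - F i q| <= r / 8.
  move=> E; apply: le_trans (dc p q i I I E) _.
  rewrite natrM ler_pdivrMr ?mulr_gt0//.
  have -> : r / 8 * (t.+1%:R * Q%:R) = Q%:R * d / 8 by rewrite dr; ring.
  lra.
(* The only residue mod t+1 of multiples of r that F_i approaches on cell b. *)
have key b i : exists v : 'I_t.+1, forall q (g : int), cell q = b ->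
    `|F i q - g%:~R * r| <= r / 4 -> (g %% t.+1%:Z)%Z = (v : nat)%:Z.
  have [[q [g [qb qg]]]|no] := pselect (exists q (g : int), cell q = b /\
      `|F i q - g%:~R * r| <= r / 4); last first.
    by exists ord0 => q g qb qg; exfalso; apply: no; exists q, g.
  have gm : (`|(g %% t.+1%:Z)%Z|%N < t.+1)%N.
    rewrite -ltz_nat gez0_abs ?modz_ge0//; exact: ltz_pmod.
  exists (Ordinal gm) => q' g' q'b q'g; rewrite /= gez0_abs ?modz_ge0//.
  suff -> : g' = g by [].
  have := close q q' i; rewrite qb q'b => /(_ erefl).
  move: qg q'g; rewrite !ler_norml => /andP[? ?] /andP[? ?] /andP[? ?].
  have H1 : (g' - g)%:~R * r < 1%:~R * r by rewrite intrD mulrDl mulrNz mulNr mul1r; lra.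
  have H2 : (g - g')%:~R * r < 1%:~R * r by rewrite intrD mulrDl mulrNz mulNr mul1r; lra.
  move: H1 H2; rewrite !ltr_pM2r// !ltr_int; clear; lia.
pose h b := projT1 (choice (key b)).
have hP b : forall i q (g : int), cell q = b -> `|F i q - g%:~R * r| <= r / 4 ->
    (g %% t.+1%:Z)%Z = (h b i : nat)%:Z := projT2 (choice (key b)).
pose H (b : 'I_n) : {ffun 'I_N -> 'I_t.+1} := [ffun i => h b i].
have [j _ jH] : exists2 j : {ffun 'I_N -> 'I_t.+1}, j \in [set: {ffun 'I_N -> 'I_t.+1}]%SET &
    j \notin [set H b | b in 'I_n]%SET.
  apply/subsetPn; apply: contraL nlt => /subset_leq_card.
  rewrite cardsT card_ffun !card_ord -leqNgt => /leq_trans; apply.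
  by rewrite (leq_trans (leq_imset_card _ _))// card_ord.
(* Shifting the offsets by a multiple of d lets the grids, which are indexed by
   nat, start below -B. *)
pose K := Num.bound (B / d).
have KP : B <= K%:R * d.
  by rewrite -ler_pdivrMr// ltW// archi_boundP// divr_ge0// ltW.
exists (r / 4), (fun i => (j i)%:R * r - K%:R * d); split.
- by rewrite divr_gt0.
- have : r <= d by rewrite dr ler_peMl ?(ltW r0)// ler1n.
  lra.
- move=> i; have : (j i)%:R * r <= d.
    by rewrite dr ler_wpM2r ?(ltW r0)// ler_nat ltnW.
  lra.
- move=> p; have pn := cn p I; pose b := Ordinal pn.
  have : j != H b by apply: contra jH => /eqP ->; apply/imsetP; exists b.
  case/eqP/ffunP/existsNP => i /eqP; rewrite ffunE => ji; exists i => k.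
  rewrite ltNge; apply: contra ji => le.
  pose g : int := (j i : nat)%:Z + (k%:Z - K%:Z) * t.+1%:Z.
  have gE : g%:~R * r = (j i)%:R * r - K%:R * d + k%:R * d.
    rewrite /g dr intrD intrM intrB -!pmulrn; ring.
  rewrite -gE in le; have := hP _ _ _ _ erefl le.
  rewrite /g addrC modzMDl modz_small ?ltz_nat ?ltn_ord// => -[ji].
  by apply/eqP/val_inj.
Qed.

End Cells.

(** * Local Lipschitz bounds *)

Section LocallyLipschitz.
Context {R : realType} {D : nat}.
Implicit Types (f : 'rV[R]_D -> R) (x y v : 'rV[R]_D).

Lemma is_derive_line {V : normedModType R} (f : V -> R) (y v : V) (t : R) :
  derivable f (y + t *: v) v ->
  is_derive t 1 (fun s => f (y + s *: v)) ('D_v f (y + t *: v)).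
Proof.
have E : (fun h : R => h^-1 *: (((fun s => f (y + s *: v)) \o shift t) (h *: (1 : R))
      - f (y + t *: v))) =
    (fun h : R => h^-1 *: ((f \o shift (y + t *: v)) (h *: v) - f (y + t *: v))).
  apply/funext => h /=; congr (_ *: (f _ - _)).
  by rewrite -[h *: (1 : R)]/(h * 1) mulr1 scalerDl addrCA.
by move=> df; apply: DeriveDef; rewrite /derivable /derive E.
Qed.

Lemma derive_row_sum f x v : differentiable f x ->
  'D_v f x = \sum_j v 0 j * 'D_('e_j) f x.
Proof.
move=> df; have -> := deriveE v df.
rewrite [in LHS](row_sum_delta v) linear_sum; apply: eq_bigr => j _.
have -> := deriveE 'e_j df.
by rewrite linearZ.
Qed.

Lemma ball_segment {V : normedModType R} (x y z : V) (e t : R) : 0 <= t <= 1 ->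
  ball x e y -> ball x e z -> ball x e (y + t *: (z - y)).
Proof.
rewrite -ball_normE /= => /andP[t0 t1] xy xz.
have -> : x - (y + t *: (z - y)) = (1 - t) *: (x - y) + t *: (x - z).
  rewrite !scalerBr !scalerBl !scale1r.
  rewrite [RHS]addrAC [in RHS]addrA subrK opprD !opprB addrA.
  by rewrite addrACA [RHS]addrACA [- y + _]addrC.
apply: le_lt_trans (ler_normD _ _) _; rewrite !normrZ (ger0_norm t0).
rewrite ger0_norm ?subr_ge0//; move: xy xz.
move: `|x - y| `|x - z| => a b ae be.
by have [->|t00] := eqVneq t 0; [lra|nra].
Qed.

(** The mean value theorem along segments of a ball on which all partial
derivatives are at most one larger, in absolute value, than at the centre. The increment
is measured coordinatewise, in the form in which cells control it. *)
Lemma Ck_on1_lipschitz (N : nat) (f : 'I_N -> 'rV[R]_D -> R) (U : set 'rV[R]_D) x :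
  open U -> U x -> (forall i, Ck_on 1 U (f i)) ->
  exists e c : R, [/\ 0 < e, 0 <= c & forall i y z h, 0 <= h -> ball x e y -> ball x e z ->
    (forall j, `|y 0 j - z 0 j| <= h) -> `|f i y - f i z| <= c * h].
Proof.
move=> oU Ux Cf.
have : \forall y \near x, U y /\
    forall (ij : 'I_N * 'I_D), `|'D_('e_ij.2) (f ij.1) y| < `|'D_('e_ij.2) (f ij.1) x| + 1.
  apply: filterI; first exact: open_nbhs_nbhs.
  apply: (@filter_forall _ _ (fun (ij : 'I_N * 'I_D) y =>
    `|'D_('e_ij.2) (f ij.1) y| < `|'D_('e_ij.2) (f ij.1) x| + 1) (nbhs x)).
  move=> -[i j] /=.
  have [_ /(_ 'e_j) /= /(_ x Ux) cD] := Cf i.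
  have cN : `|'D_('e_j) (f i) y| @[y --> x] --> `|'D_('e_j) (f i) x|.
    exact: (continuous_comp cD (@norm_continuous _ _ _)).
  have lt1 : `|'D_('e_j) (f i) x| < `|'D_('e_j) (f i) x| + 1 by rewrite ltrDl.
  exact: (cvgr_lt _ cN _ lt1).
move=> /nbhs_ballP[e /= e0 eU].
exists e, (\sum_(ij : 'I_N * 'I_D) (`|'D_('e_ij.2) (f ij.1) x| + 1)); split=> //.
  by apply: sumr_ge0 => ij _; rewrite addr_ge0.
move=> i y z h h0 xy xz yz.
pose v : 'rV[R]_D := y - z; pose g (s : R) := f i (z + s *: v).
have seg (s : R) : 0 <= s <= 1 -> ball x e (z + s *: v) by move=> s01; exact: ball_segment.
have dfi w : ball x e w -> differentiable (f i) w.
  by move=> /eU[Uw _]; have [df _] := Cf i; exact: df.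
have dg (s : R) : 0 <= s <= 1 -> is_derive s 1 g ('D_v (f i) (z + s *: v)).
  by move=> /seg /dfi dd; apply: is_derive_line; exact: diff_derivable.
have [|||s s01 gE] := @MVT_segment R g (fun s => 'D_v (f i) (z + s *: v)) 0 1.
- exact: ler01.
- move=> s; rewrite in_itv /= => /andP[s0 s1]; apply: dg.
  by rewrite !ltW.
- apply: derivable_within_continuous => s; rewrite in_itv /= => s01.
  exact: (@ex_derive _ _ _ _ _ _ _ (dg s s01)).
move: gE; rewrite /g scale1r scale0r addr0 subr0 mulr1 /v subrKC -/v => ->.
move: s01; rewrite in_itv /= => /seg sb.
rewrite (derive_row_sum _ (dfi _ sb)); apply: le_trans (ler_norm_sum _ _ _) _.
apply: (@le_trans _ _ (\sum_(j < D) (`|'D_('e_j) (f i) x| + 1) * h)).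
  apply: ler_sum => j _; rewrite normrM mulrC ler_pM//.
    by have [_ /(_ (i, j)) /ltW] := eU _ sb.
  by rewrite /v !mxE; exact: yz.
rewrite -mulr_suml ler_wpM2r//.
rewrite -(pair_bigA _ (fun i j => `|'D_('e_j) (f i) x| + 1))/= (bigD1 i)//= lerDl.
by apply: sumr_ge0 => ? _; apply: sumr_ge0 => ? _; rewrite addr_ge0.
Qed.

End LocallyLipschitz.

(** * Cells on a manifold *)

Section ManifoldCells.
Context {R : realType} {m : nat} {M : smooth_manifold R m}.

Lemma smooth_fun_continuous (G : M -> R) (p : M) :
  smooth_fun G -> {for p, continuous G}.
Proof.
move=> sG; set c := atlas (chart_at p).
have cp : chart_dom c p := chart_atP p.
have cx : chart_codom c (chart_map c p) by exists p.
have cf : {for p, continuous (local_expr (chart_at p) G \o chart_map c)}.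
  apply: continuous_comp; first exact: chart_map_continuous.
  apply: differentiable_continuous; exact: smooth_on_differentiable (sG _) cx.
have E : (local_expr (chart_at p) G \o chart_map c) p = G p.
  by rewrite /local_expr /= chart_mapK.
have {}cf : (local_expr (chart_at p) G \o chart_map c) @ p --> G p by rewrite -E.
apply: cvg_trans cf; apply: near_eq_cvg.
have : nbhs p (chart_dom c) by apply: open_nbhs_nbhs; split=> //; exact: chart_dom_open.
by apply: filterS => q cq; rewrite /local_expr /= chart_mapK.
Qed.

Lemma Cc_infty_comp (G : M -> R) (phi : R -> R) :
  (forall k, Ck_on k [set: R] phi) -> phi 0 = 0 -> Cc_infty M G ->
  Cc_infty M (phi \o G).
Proof.
move=> sphi phi0 [sG cG]; split.
  by move=> i k; apply: Ck_on_comp; [exact: chart_codom_open|exact: sphi|exact: sG].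
apply: (subclosed_compact _ cG); first exact: closed_closure.
apply: closureS => p /=; apply: contra => /eqP ->; exact/eqP.
Qed.

(** Cut a small coordinate cube into m^dim equal subcubes; the functions are
Lipschitz in the coordinates. *)
Lemma cellular_nbhs (N : nat) (F : 'I_N -> M -> R) (p : M) :
  (forall i, smooth_fun (F i)) -> exists2 U, nbhs p U & cellular F m U.
Proof.
move=> sF; set c := atlas (chart_at p); set x := chart_map c p.
have cp : chart_dom c p := chart_atP p.
have cx : chart_codom c x by exists p.
have [e [b [e0 b0 Lip]]] := Ck_on1_lipschitz (@chart_codom_open _ _ _ c) cx
  (fun i => sF i (chart_at p) 1%N).
exists (chart_dom c `&` chart_map c @^-1` ball x e).
  apply: filterI; first by apply: open_nbhs_nbhs; split=> //; exact: chart_dom_open.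
  by apply: (chart_map_continuous cp); exact: nbhsx_ballx.
have FE i q : chart_dom c q -> F i q = local_expr (chart_at p) (F i) (chart_map c q).
  by move=> cq; rewrite /local_expr /= chart_mapK.
have coord (y : 'rV[R]_m) j : ball x e y -> `|y 0 j - x 0 j| < e.
  by rewrite distrC => -[_ /(_ 0 j)].
(* 2 b e / k bounds the oscillation on a subcube, and |F_i(p)| + b e bounds F_i
   on the whole cube; B dominates both constants. *)
pose B : R := \sum_i `|F i p| + 2 * b * e.
have BE : 2 * b * e <= B /\ forall i, `|F i p| + b * e <= B.
  have be : 0 <= b * e by rewrite mulr_ge0// ltW.
  split=> [|i]; first by rewrite /B lerDr; apply: sumr_ge0.
  rewrite /B (bigD1 i)//= -!addrA lerD2l.
  have : 0 <= \sum_(j | j != i) `|F j p| by apply: sumr_ge0.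
  lra.
have [C0 BC] : exists C : nat, (0 < C)%N /\ B <= C%:R.
  exists (Num.bound `|B|).+1; split=> //.
  apply: le_trans (ler_norm B) _; apply/ltW; apply: lt_trans (archi_boundP _) _ => //.
  by rewrite ltr_nat.
exists C0; case: BC => C00 BC; split.
  move=> q i [cq qb]; have [_ /(_ i) Bi] := BE.
  have := Lip i _ x e (ltW e0) qb (ballxx _ e0) (fun j => ltW (coord _ j qb)).
  rewrite -!FE// => H.
  have := ler_normD (F i q - F i p) (F i p); rewrite subrK => H2.
  lra.
case=> // k _; pose w (y : 'rV[R]_m) j := (y 0 j - x 0 j + e) * k.+1%:R / (2 * e).
have e20 : 0 < 2 * e by lra.
pose code (q : M) : {ffun 'I_m -> 'I_k.+1} :=
  [ffun j => inord (Num.truncn (w (chart_map c q) j))].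
exists (fun q => enum_rank (code q) : nat).
split=> [q _|q q' i [cq qb] [cq' qb'] /ord_inj /enum_rank_inj E].
  apply: leq_trans (ltn_ord _) _.
  by rewrite card_ffun !card_ord leq_pmull.
have wP y j : ball x e y -> 0 <= w y j < k.+1%:R.
  move=> /(coord y j); rewrite ltr_norml => /andP[? ?]; rewrite /w.
  rewrite divr_ge0 ?(ltW e20) ?mulr_ge0//=; last by lra.
  by rewrite ltr_pdivrMr// mulrC ltr_pM2l//; lra.
have same j : `|chart_map c q 0 j - chart_map c q' 0 j| <= 2 * e / k.+1%:R.
  have := congr1 (fun g : {ffun 'I_m -> 'I_k.+1} => g j) E; rewrite !ffunE.
  have [w0 w1] := andP (wP _ j qb); have [w0' w1'] := andP (wP _ j qb').
  move=> /(congr1 val); rewrite /= !inordK ?truncn_lt_nat// => Ej.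
  have /andP[a1 a2] := truncn_itv w0; have /andP[a1' a2'] := truncn_itv w0'.
  rewrite Ej in a1 a2; rewrite -natr1 in a2 a2'.
  have : `|w (chart_map c q) j - w (chart_map c q') j| <= 1.
    by rewrite ler_norml; apply/andP; split; lra.
  have -> : w (chart_map c q) j - w (chart_map c q') j =
     (chart_map c q 0 j - chart_map c q' 0 j) * (k.+1%:R / (2 * e)).
    rewrite /w; ring.
  have r0 : 0 < k.+1%:R / (2 * e) by rewrite divr_gt0.
  rewrite normrM (gtr0_norm r0) -ler_pdivlMr// div1r invf_div//.
have := Lip i _ _ _ _ qb qb' same; rewrite -!FE// => H.
have h0 : 0 <= 2 * e / k.+1%:R by rewrite divr_ge0// ltW.
apply: le_trans (H h0) _; rewrite mulrA ler_wpM2r ?invr_ge0//.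
have [BE1 _] := BE; lra.
Qed.

(** The finitely many supports are compact, and the complement of their union
counts as one more cell, since all functions vanish there. *)
Lemma Cc_infty_cellular (N : nat) (F : 'I_N -> M -> R) :
  (forall i, Cc_infty M (F i)) -> cellular F m setT.
Proof.
move=> sF; pose K (s : seq 'I_N) := [set p | exists2 i, i \in s & F i p != 0].
have cK i : cellular F m (closure [set p | F i p != 0]).
  apply: compact_ind.
  - by have [] := sF i.
  - exact: cellular0.
  - exact: cellularS.
  - exact: cellularU.
  - by move=> p _; apply: cellular_nbhs => j; have [] := sF j.
have cs (s : seq 'I_N) : cellular F m (K s).
  elim: s => [|i s IH]; first by apply: cellular0 => p i [].
  apply: cellularS (cellularU (cK i) IH) => p [j]; rewrite inE => /orP[/eqP ->|js] jp.
    by left; exact: subset_closure.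
  by right; exists j.
have c0 : cellular F m [set p | forall i, F i p = 0] by apply: cellular0 => p i; exact.
apply: cellularS (cellularU (cs (enum 'I_N)) c0) => p _.
have [p0|/existsNP[i ip]] := pselect (forall i, F i p = 0); first by right.
by left; exists i; [rewrite mem_enum|exact/eqP].
Qed.

End ManifoldCells.

(** * Brackets with a locally constant entry *)

Section LocallyConstant.
Context {R : realType} {m : nat} {M : symplectic_manifold R m}.
Implicit Types F G : M -> R.

Definition locally_cst F (p : M) := \forall q \near p, F q = F p.

Lemma locally_cst_near F p : locally_cst F p -> \forall q \near p, locally_cst F q.
Proof.
rewrite /locally_cst; move=> /nbhs_interior; apply: filterS => q /= Fq.
by have Eq := nbhs_singleton Fq; apply: filterS Fq => z ->.
Qed.

Lemma diff_locally_cst F p v : locally_cst F p ->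
  'd (local_expr (chart_at p) F) (chart_map (atlas (chart_at p)) p) v = 0.
Proof.
move=> Fp; set c := atlas (chart_at p); set x := chart_map c p.
have cp : chart_dom c p := chart_atP p.
have cx : chart_codom c x by exists p.
have E : {near x, cst (F p) =1 local_expr (chart_at p) F}.
  have H : chart_inv c @ x --> p.
    by rewrite -[X in _ --> X](chart_mapK cp); exact: chart_inv_continuous.
  suff S : [set y | F (chart_inv c y) = F p] `<=`
      [set y | cst (F p) y = local_expr (chart_at p) F y].
    exact: filterS S (H [set q | F q = F p] Fp).
  by move=> y /= <-.
have d0 : differentiable (cst (F p) : 'rV[R]_m -> R) x by exact: differentiable_cst.
rewrite -(near_eq_diff v d0 (near_eq_differentiable E d0) E).
by rewrite diff_cst.
Qed.

Lemma poisson_locally_cst F G p : locally_cst F p \/ locally_cst G p ->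
  poisson F G p = 0.
Proof.
rewrite /poisson /chart_bracket => -[Fp|Gp]; first by rewrite diff_locally_cst.
set c := atlas (chart_at p); set x := chart_map c p.
have cx : chart_codom c x by exists p; [exact: chart_atP|].
rewrite (_ : ham_vec _ _ _ = 0) ?linear0//.
apply: (symplectic_nondegenerate cx) => v.
by rewrite ham_vecP// diff_locally_cst// oppr0.
Qed.

(** A single function is locally constant without being zero, whence the two
parts of the conclusion: the induction needs the first one for the inner
bracket, at all points near p, and already the outermost bracket is then zero
near p. *)
Lemma nested_bracket_locally_cst (I : eqType) (F : I -> M -> R) (s : seq I) i p :
  i \in s -> locally_cst (F i) p ->
  locally_cst (nested_bracket [seq F j | j <- s]) p /\
  ((1 < size s)%N -> nested_bracket [seq F j | j <- s] p = 0).
Proof.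
elim: s => // j [|k s] IH; first by rewrite inE => /eqP ->.
move=> jis Fi; set G := nested_bracket [seq F j | j <- k :: s] in IH.
have H : \forall q \near p, locally_cst (F j) q \/ locally_cst G q.
  move: jis; rewrite inE => /orP[/eqP ij|js].
    by apply: filterS (locally_cst_near Fi) => q; rewrite ij; left.
  by apply: filterS (locally_cst_near (IH js Fi).1) => q; right.
have Z : \forall q \near p, poisson (F j) G q = 0.
  by apply: filterS H => q; exact: poisson_locally_cst.
have Zp := nbhs_singleton Z.
split=> [|_]; last exact: Zp.
by apply: filterS Z => q Zq; rewrite [LHS]Zq [RHS]Zp.
Qed.

End LocallyConstant.

Lemma uniform_norm_le (R : realType) (m : nat) (M : smooth_manifold R m)
    (G : M -> R) (b : R) :
  0 <= b -> (forall p, `|G p| <= b) -> uniform_norm G <= b.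
Proof.
move=> b0 Gb; rewrite /uniform_norm.
have [[p _]|nM] := pselect (exists p : M, True).
  by apply: sup_le_ub; [exists `|G p|, p|move=> _ [q _ <-]].
rewrite (_ : [set _ | _ in _] = set0) ?sup0//.
by apply/seteqP; split=> // t [q _ _]; apply: nM; exists q.
Qed.

(** * Approximation by functions with vanishing iterated bracket *)

Theorem theorem1p4 (n : nat) (hn : (1 <= n)%N) :
  exists N : nat, (1 <= N)%N /\
    forall (R : realType) (M : symplectic_manifold R (2 * n)%N)
           (F : 'I_N -> M -> R),
      (forall i, Cc_infty M (F i)) ->
      forall eps : R, 0 < eps ->
      exists F' : 'I_N -> M -> R,
        [/\ forall i, Cc_infty M (F' i),
            forall i, uniform_norm (fun p => F' i p - F i p) < eps
          & forall p, nested_bracket [seq F' i | i <- enum 'I_N] p = 0].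
Proof.
exists (2 * n).+1; split=> // R M F sF eps eps0.
have cF := Cc_infty_cellular sF; have [C [FC _]] := cF.
have d0 : 0 < eps / 5 by rewrite divr_gt0.
have [e [a [e0 ed aC away]]] := avoiding_grids (erefl _) d0 (ler0n R C) cF.
have phiP i := exists_quantizer e0 ed (aC i) (ler0n R C).
have [phi phiE] := choice phiP.
exists (fun i => phi i \o F i); split.
- by move=> i; have [sphi phi0 _ _] := phiE i; exact: Cc_infty_comp.
- move=> i; have [_ _ phid _] := phiE i.
  apply: (@le_lt_trans _ _ (4 * (eps / 5))); last by lra.
  by apply: uniform_norm_le => [|p]; [lra|apply: phid; exact: FC].
move=> p; have [i ip] := away p; have [_ _ _ loc] := phiE i.
have Fi : locally_cst (phi i \o F i) p.
  have cFi := smooth_fun_continuous (p := p) (sF i).1.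
  exact: (cFi [set u | phi i u = phi i (F i p)] (loc _ ip)).
have [_] := nested_bracket_locally_cst (s := enum 'I_(2 * n).+1) (F := fun i => phi i \o F i)
  (mem_enum _ i) Fi.
by apply; rewrite size_enum_ord ltnS muln_gt0.
Qed.
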